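(* Let $U,V\subset\mathbb{R}^n$ be open sets, let $p\in V$, and let $\psi\in C^{\infty}(U\times V)$ be a real-valued function that is analytic in $V$ about the point $p$, with Taylor functions $c_s:U\to\mathbb{R}$ (indexed by multi-indices $s$). Let $k\in\mathbb{N}$. Then the following three conditions are equivalent: (1) $\mathrm{rank}(\psi)=k$. (2) $\psi(x,y)=\sum_{j=1}^k f_j(x)g_j(y)$ for linearly independent functions $f_1,\dots,f_k\in C^\infty(U)$ and linearly independent functions $g_1,\dots,g_k\in C^\infty(V)$. (3) There are linearly independent functions $f_1,\dots,f_k\in C^{\infty}(U)$ such that all Taylor functions $c_s$ are their linear combinations in $U$, i.e. $c_s\in \mathrm{span}\{f_1,\dots,f_k\}$ for all multi-indices $s$.
   Context: A collection of functions $f_s:U\to\mathbb{R}$ is linearly independent in $U$ if $\sum_s\alpha_s f_s(x)=0$ for almost all (Lebesgue) $x\in U$ only if $\alpha_s=0$ for all $s$. Rank of a function: $\psi:U\times V\to\mathbb{R}$ has rank $k$, written $\mathrm{rank}(\psi)=k$, if for any $m\in\mathbb{N}$, $x_1,\dots,x_m\in U$ and $y_1,\dots,y_m\in V$ one has $\mathrm{rank}(\{\psi(x_i,y_j)\}_{i,j=1}^{m})\le k$, and $k$ is the smallest number with this property. Analyticity: a smooth $\psi$ is analytic in $V$ about $p\in V$ if it has a Taylor expansion in $y\in V$: for all $x\in U$, $y\in V$, $\psi(x,y)=\sum_{m=0}^\infty\ \sum_{s:\,[s]=m} c_s(x)(y-p)^s$, where $s=(s_1,\dots,s_n)$ is a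 multi-index of non-negative integers, $[s]=s_1+\dots+s_n$, and $(y-p)^s=(y_1-p_1)^{s_1}\cdots(y_n-p_n)^{s_n}$. The functions $c_s$ are called the Taylor functions of $\psi$.
   Formalization: In condition (3), k is additionally required to be the smallest number for which such linearly independent functions exist; as written (3) only gives rank(ψ) ≤ k (e.g. ψ = 0, k = 1, f_1 = 1 satisfies (3) though the rank is 0). *)

(* Defs.v *)
From HB Require Import structures.
From mathcomp Require Import all_boot all_order all_algebra.
From mathcomp Require Import all_classical all_reals all_analysis.
Import Order.TTheory GRing.Theory Num.Theory.
Import numFieldNormedType.Exports.

Set Implicit Arguments.
Unset Strict Implicit.
Unset Printing Implicit Defensive.

Local Open Scope classical_set_scope.
Local Open Scope ring_scope.

(* Points of R^n are row vectors 'rV[R]_n.  A function on a set U is a total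
   function of which every notion below only uses the values on U (for smooth,
   U is meant to be open, so derivatives at points of U only depend on
   these values). *)

(* C^m on an open subset of a finite-dimensional space: all iterated
   directional derivatives of order at most m exist and are continuous. *)
Fixpoint smooth_upto (R : realType) (W : normedModType R) (m : nat)
    (A : set W) (f : W -> R) : Prop :=
  (forall x, A x -> {for x, continuous f}) /\
  if m is m'.+1 then
    forall v : W, (forall x, A x -> derivable f x v) /\
                  smooth_upto m' A (fun x => 'D_v f x)
  else True.

Definition smooth (R : realType) (W : normedModType R)
    (A : set W) (f : W -> R) : Prop :=
  forall m : nat, smooth_upto m A f.

Definition open_box (R : realType) (n : nat) (a b : 'rV[R]_n) : set 'rV[R]_n :=
  [set x | forall i, a 0 i < x 0 i < b 0 i].

(* Sets of n-dimensional Lebesgue measure zero: for every e > 0 there is a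
   countable cover by boxes of total volume at most e.  The index set D may be
   finite or empty, so that the empty set is null also when n = 0, where the
   only box is a point of volume 1. *)
Definition lebesgue_null (R : realType) (n : nat) (N : set 'rV[R]_n) : Prop :=
  forall e : R, 0 < e ->
  exists (D : set nat) (a b : nat -> 'rV[R]_n),
    [/\ forall m i, a m 0 i <= b m 0 i,
        N `<=` \bigcup_(m in D) open_box (a m) (b m) &
        (\esum_(m in D) (\prod_(i < n) (b m 0 i - a m 0 i))%:E <= e%:E)%E].

Definition for_almost_all (R : realType) (n : nat) (U : set 'rV[R]_n)
    (P : 'rV[R]_n -> Prop) : Prop :=
  lebesgue_null [set x | U x /\ ~ P x].

Definition linearly_independent (R : realType) (n k : nat) (U : set 'rV[R]_n)
    (f : 'I_k -> 'rV[R]_n -> R) : Prop :=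
  forall alpha : 'I_k -> R,
    for_almost_all U (fun x => \sum_(j < k) alpha j * f j x = 0) ->
    forall j, alpha j = 0.

Definition rank_le (R : realType) (n : nat) (U V : set 'rV[R]_n)
    (psi : 'rV[R]_n -> 'rV[R]_n -> R) (k : nat) : Prop :=
  forall (m : nat) (x y : 'I_m -> 'rV[R]_n),
    (forall i, U (x i)) -> (forall j, V (y j)) ->
    (\rank (\matrix_(i < m, j < m) psi (x i) (y j)) <= k)%N.

Definition has_rank (R : realType) (n : nat) (U V : set 'rV[R]_n)
    (psi : 'rV[R]_n -> 'rV[R]_n -> R) (k : nat) : Prop :=
  rank_le U V psi k /\ forall k', rank_le U V psi k' -> (k <= k')%N.

Definition multi_index (n : nat) := {ffun 'I_n -> nat}.

Definition monomial (R : realType) (n : nat) (v : 'rV[R]_n)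
    (s : multi_index n) : R :=
  \prod_(i < n) v 0 i ^+ s i.

(* The entries of a multi-index of weight m are at most m, hence the finite
   summation type. *)
Definition taylor_term (R : realType) (n : nat) (p : 'rV[R]_n)
    (c : multi_index n -> 'rV[R]_n -> R) (x y : 'rV[R]_n) (m : nat) : R :=
  \sum_(t : {ffun 'I_n -> 'I_m.+1} | (\sum_(i < n) (t i : nat))%N == m)
    let s : multi_index n := [ffun i => t i : nat] in
    c s x * monomial (y - p) s.

Definition taylor_functions (R : realType) (n : nat) (U V : set 'rV[R]_n)
    (p : 'rV[R]_n) (psi : 'rV[R]_n -> 'rV[R]_n -> R)
    (c : multi_index n -> 'rV[R]_n -> R) : Prop :=
  forall x y, U x -> V y -> series (taylor_term p c x y) @ \oo --> psi x y.

Definition in_span (R : realType) (n k : nat) (U : set 'rV[R]_n)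
    (f : 'I_k -> 'rV[R]_n -> R) (h : 'rV[R]_n -> R) : Prop :=
  exists a : 'I_k -> R, forall x, U x -> h x = \sum_(j < k) a j * f j x.

Definition separates (R : realType) (n : nat) (U V : set 'rV[R]_n)
    (psi : 'rV[R]_n -> 'rV[R]_n -> R) (k : nat) : Prop :=
  exists f g : 'I_k -> 'rV[R]_n -> R,
    [/\ forall j, smooth U (f j), forall j, smooth V (g j),
        linearly_independent U f, linearly_independent V g &
        forall x y, U x -> V y -> psi x y = \sum_(j < k) f j x * g j y].

Definition taylor_spanned (R : realType) (n : nat) (U : set 'rV[R]_n)
    (c : multi_index n -> 'rV[R]_n -> R) (k : nat) : Prop :=
  exists f : 'I_k -> 'rV[R]_n -> R,
    [/\ forall j, smooth U (f j), linearly_independent U f &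
        forall s, in_span U f (c s)].

(* taylor_spanned only bounds the rank from above: for psi = 0 and U nonempty
   with n > 0 it holds for every k.  As in has_rank, k has to be the smallest
   such number. *)
Definition taylor_spanned_min (R : realType) (n : nat) (U : set 'rV[R]_n)
    (c : multi_index n -> 'rV[R]_n -> R) (k : nat) : Prop :=
  taylor_spanned U c k /\ forall k', taylor_spanned U c k' -> (k <= k')%N.

(* Main.v *)
Require Import Defs.
From mathcomp Require Import all_boot all_order all_algebra finmap.
From mathcomp Require Import all_classical all_reals all_analysis.
From mathcomp Require Import lra.
Import Order.TTheory GRing.Theory Num.Theory.
Import numFieldNormedType.Exports.

Set Implicit Arguments.
Unset Strict Implicit.
Unset Printing Implicit Defensive.

Local Open Scope classical_set_scope.
Local Open Scope ring_scope.

(** The theorem rests on one interpolation formula.  If psi has rank k, some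
    sample matrix A = (psi (x_i) (y_j)) of size k is invertible; bordering A by
    one more row u and one more column v cannot raise the rank, so the Schur
    complement of A vanishes:
      psi u v = sum_(i, j) psi u (y_j) * (A^-1)_(j, i) * psi (x_i) v
    (rank_le_interpolation).  The slices f_j = psi(-, y_j) are smooth, and so
    are the combinations g_j of the slices psi(x_i, -); both families are
    independent because their values at the sample points form invertible
    matrices.  Conversely, linearly independent functions always have an
    invertible sample matrix (exists_unit_sample), so the sum of the products
    of two independent families of k functions has rank exactly k.

    For the Taylor functions, fix points x_i, a point u and weights w_i.
    Comparing Taylor coefficients shows that psi(u, -) is the combination of
    the psi(x_i, -) with weights w_i on V if and only if each c_s(u) is the
    same combination of the c_s(x_i) (taylor_relationP).  One direction is
    uniqueness of limits, the other uniqueness of Taylor coefficients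
    (taylor_expansion_eq0).  Hence rank k makes every c_s a combination of the
    f_j above.  If on the other hand all c_s lie in the span of k' independent
    functions, interpolation at an invertible sample of these functions writes
    psi as a sum of k' products, so the rank is at most k'.  The two bounds
    together identify the rank with the smallest such k'.

    Independence is meant almost everywhere.  For continuous functions on an
    open set this agrees with vanishing everywhere, since a nonempty open set
    is not null (open_lebesgue_null).  That fact is proved by counting the
    points of a fine grid in a cube: by compactness finitely many boxes cover
    the cube, and a box contains about as many grid points as its volume
    predicts. *)

(** * Invertible minors and bordered matrices *)

Lemma exists_rowsub_free (F : fieldType) (m n r : nat) (A : 'M[F]_(m, n)) :
  \rank A = r -> exists h : 'I_r -> 'I_m, row_free (rowsub h A).
Proof. by move=> <-; exists (maxrankfun A); exact: maxrowsub_free. Qed.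

Lemma exists_unit_minor (F : fieldType) (m n r : nat) (A : 'M[F]_(m, n)) :
  \rank A = r -> exists (h : 'I_r -> 'I_m) (l : 'I_r -> 'I_n),
    mxsub h l A \in unitmx.
Proof.
move=> /exists_rowsub_free [h hfree].
have /exists_rowsub_free [l lfree] : \rank (rowsub h A)^T = r.
  by rewrite mxrank_tr; exact/eqP.
exists h, l; rewrite -unitmx_tr -row_free_unit.
by congr (row_free _): lfree; apply/matrixP => i j; rewrite !mxE.
Qed.

(** Points are found one at a time: as long as there are fewer than k rows, a
    nonzero coefficient vector a is orthogonal to all of them; independence
    gives a point where the combination with coefficients a is nonzero, and the
    row of values there is not in the span of the previous ones. *)
Lemma exists_unit_sample (F : fieldType) (T : Type) (k : nat) (U : set T)
    (f : 'I_k -> T -> F) :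
  (forall alpha : 'I_k -> F,
    (forall x, U x -> \sum_(j < k) alpha j * f j x = 0) ->
    forall j, alpha j = 0) ->
  exists x : 'I_k -> T,
    (forall i, U (x i)) /\ \matrix_(i < k, j < k) f j (x i) \in unitmx.
Proof.
move=> findep.
suff [x [Ux xfree]] : exists x : 'I_k -> T, (forall i, U (x i)) /\
    row_free (\matrix_(i < k, j < k) f j (x i)).
  by exists x; split=> //; rewrite -row_free_unit.
suff: forall r, (r <= k)%N -> exists x : 'I_r -> T, (forall i, U (x i)) /\
    row_free (\matrix_(i < r, j < k) f j (x i)) by apply.
elim=> [_|r IH rk].
  exists (fun i : 'I_0 => False_rect T (notF (ltn_ord i))).
  by split=> [[]//|]; rewrite /row_free -leqn0 rank_leq_row.
have [x [Ux xfree]] := IH (ltnW rk).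
set A := (\matrix_(i, j) _) in xfree.
(* A nonzero vector of coefficients that all the points found so far kill. *)
have : kermx A^T != 0.
  rewrite -mxrank_eq0 mxrank_ker mxrank_tr (eqP xfree) subn_eq0 -ltnNge.
  exact: rk.
move=> /rowV0Pn[a /sub_kermxP aA a0].
have [x0 Ux0 ax0] : exists2 x0, U x0 & \sum_(j < k) a 0 j * f j x0 != 0.
  apply: contrapT => noxa; case/eqP: a0; apply/rowP => j; rewrite mxE.
  apply: (findep (a 0)) => x0 Ux0; apply: contrapT => /eqP ax0.
  by apply: noxa; exists x0.
rewrite -addn1.
exists (fun i : 'I_(r + 1) => if fintype.split i is inl i then x i else x0).
split.
  by move=> i; case: fintype.split.
set B := (\matrix_(i, j) _).
have -> : B = col_mx A (\row_j f j x0).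
  by apply/matrixP => i j; rewrite !mxE; case: fintype.split => i'; rewrite mxE.
suff : (\rank A < \rank (col_mx A (\row_j f j x0)))%N.
  rewrite (eqP xfree) => rlt.
  by rewrite /row_free eqn_leq rank_leq_row (leq_trans _ rlt) ?addn1.
apply: rank_ltmx; rewrite ltmxE; apply/andP; split.
  by rewrite -addsmxE addsmxSl.
apply/negP; rewrite col_mx_sub => /andP[_ /submxP[D vD]].
case/negP: ax0; apply/eqP.
transitivity ((a *m (\row_j f j x0)^T) 0 0).
  by rewrite mxE; apply: eq_bigr => j _; rewrite !mxE.
by rewrite vD trmx_mul mulmxA aA mul0mx mxE.
Qed.

(** The top k rows of the block matrix already have rank k, so the last row
    is a combination D of them; the first k columns force D = r *m invmx A. *)
Lemma schur_complement_eq0 (F : fieldType) (k : nat) (A : 'M[F]_k)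
    (b : 'cV[F]_k) (r : 'rV[F]_k) (d : 'M[F]_1) :
  A \in unitmx -> (\rank (block_mx A b r d) <= k)%N -> d = r *m invmx A *m b.
Proof.
move=> Aunit rk.
have Atop : \rank (row_mx A b) = k.
  apply/eqP/row_freeP; exists (col_mx (invmx A) 0).
  by rewrite mul_row_col mulmxV // mulmx0 addr0.
have /submxP[D] : (row_mx r d <= row_mx A b)%MS.
  have topsub : (row_mx A b <= block_mx A b r d)%MS.
    by rewrite /block_mx -addsmxE addsmxSl.
  have : (block_mx A b r d <= row_mx A b)%MS.
    by rewrite -(mxrank_leqif_sup topsub).2 eqn_leq mxrankS //= Atop.
  by rewrite /block_mx col_mx_sub => /andP[].
rewrite mul_mx_row => /eq_row_mx[-> ->].
by rewrite mulmxK.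
Qed.

(** * Interpolation of functions of finite rank *)

Section FiniteRank.
Variables (R : realType) (n : nat) (U V : set 'rV[R]_n).
Variable psi : 'rV[R]_n -> 'rV[R]_n -> R.

Definition sample_mx (m l : nat) (x : 'I_m -> 'rV[R]_n)
    (y : 'I_l -> 'rV[R]_n) :=
  \matrix_(i < m, j < l) psi (x i) (y j).

Lemma has_rank_exists (k : nat) :
  rank_le U V psi k -> exists2 r, (r <= k)%N & has_rank U V psi r.
Proof.
move=> rk.
have ex : exists r, `[< rank_le U V psi r >] by exists k; exact/asboolP.
have [r /asboolP rr rmin] := ex_minnP ex.
exists r; first by apply: rmin; exact/asboolP.
by split=> // k' /asboolP; exact: rmin.
Qed.

Lemma has_rank_unit_sample (k : nat) : has_rank U V psi k ->
  exists x y : 'I_k -> 'rV[R]_n,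
    [/\ forall i, U (x i), forall j, V (y j) & sample_mx x y \in unitmx].
Proof.
move=> [rk kmin].
have [m [x [y [Ux Vy krank]]]] : exists m (x y : 'I_m -> 'rV[R]_n),
    [/\ forall i, U (x i), forall j, V (y j) & (k <= \rank (sample_mx x y))%N].
  apply: contrapT => nosample.
  case: k rk kmin nosample => [|k] rk kmin nosample.
    apply: nosample.
    pose e (i : 'I_0) := False_rect 'rV[R]_n (notF (ltn_ord i)).
    by exists 0%N, e, e; split=> // -[].
  have /kmin : rank_le U V psi k; last by rewrite ltnn.
  move=> m x y Ux Vy; rewrite leqNgt; apply/negP => klt.
  by apply: nosample; exists m, x, y.
have rank_eq : \rank (sample_mx x y) = k.
  by apply/eqP; rewrite eqn_leq krank andbT rk.
have [h [l hl]] := exists_unit_minor rank_eq.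
exists (x \o h), (y \o l); split=> [i|j|]; [exact: Ux|exact: Vy|].
suff -> : sample_mx (x \o h) (y \o l) = mxsub h l (sample_mx x y) by [].
by apply/matrixP => i j; rewrite !mxE.
Qed.

(** This is the vanishing of the Schur complement of the sample matrix in the
    sample matrix with u and v adjoined. *)
Lemma rank_le_interpolation (k : nat) (x y : 'I_k -> 'rV[R]_n) u v :
  rank_le U V psi k -> (forall i, U (x i)) -> (forall j, V (y j)) ->
  sample_mx x y \in unitmx -> U u -> V v ->
  psi u v = \sum_j psi u (y j) *
    \sum_i invmx (sample_mx x y) j i * psi (x i) v.
Proof.
move=> rk Ux Vy Aunit Uu Vv.
pose x' (i : 'I_(k + 1)) := if fintype.split i is inl i then x i else u.
pose y' (i : 'I_(k + 1)) := if fintype.split i is inl i then y i else v.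
have blockE : sample_mx x' y' = block_mx (sample_mx x y)
    (\col_i psi (x i) v) (\row_j psi u (y j)) (psi u v)%:M.
  apply/matrixP => i j; rewrite !mxE /x' /y'.
  by case: fintype.split => i'; rewrite mxE; case: fintype.split => j';
    rewrite !mxE ?ord1.
have /(schur_complement_eq0 Aunit) /matrixP/(_ 0 0) :
    (\rank (block_mx (sample_mx x y) (\col_i psi (x i) v)
      (\row_j psi u (y j)) (psi u v)%:M) <= k)%N.
  rewrite -blockE; apply: rk => i; rewrite /x' /y'; by case: fintype.split.
rewrite mxE eqxx mulr1n -mulmxA mxE => ->; apply: eq_bigr => j _; rewrite !mxE.
by congr (_ * _); apply: eq_bigr => i _; rewrite !mxE.
Qed.
End FiniteRank.

(** * Nonempty open sets are not Lebesgue null *)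

(** Stated for real endpoints, because grid points are compared with the
    rescaled sides of arbitrary boxes; the excess 1 is what the mesh tending
    to 0 makes negligible. *)
Lemma card_ord_interval (R : realType) (N : nat) (lo hi : R) : lo <= hi ->
  #|[pred z : 'I_N | lo < z%:R < hi]|%:R <= hi - lo + 1.
Proof.
move=> lohi; set P := [pred z | _].
have [P0|] := eqVneq #|P| 0%N; first by rewrite P0; lra.
rewrite -lt0n => /card_gt0P[z0 Pz0].
have [a Pa amin] := @arg_minnP _ z0 P (fun z => z : nat) Pz0.
have [b Pb bmax] := @arg_maxnP _ z0 P (fun z => z : nat) Pz0.
have leab : (a <= b)%N by exact: amin.
have : (#|P| <= (b - a).+1)%N.
  rewrite cardE -(size_map val) -[X in (_ <= X)%N](size_iota a).
  apply: (@uniq_leq_size nat); first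
    by rewrite map_inj_uniq ?enum_uniq//; exact: val_inj.
  move=> y /mapP[z]; rewrite mem_enum => Pz ->; rewrite mem_iota.
  rewrite -subSn // subnKC; last exact: leqW.
  by rewrite amin //= ltnS; exact: bmax.
rewrite -(ler_nat R) => /le_trans; apply.
rewrite -addn1 natrD natrB // lerD2r.
move: Pa Pb => /andP[loa _] /andP[_ bhi]; lra.
Qed.

Section Covers.
Variables (R : realType) (n : nat).

Definition cube (c : 'rV[R]_n) (d : R) : set 'rV[R]_n :=
  [set x | forall i, `[c 0 i, c 0 i + d]%classic (x 0 i)].

Lemma compact_cube c d : compact (cube c d).
Proof.
by apply: (rV_compact (A := fun i => `[c 0 i, c 0 i + d]%classic)) => i;
  exact: segment_compact.
Qed.

Lemma open_open_box (a b : 'rV[R]_n) : open (open_box a b).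
Proof.
rewrite openE => x abx.
apply: (@filter_forall _ _ (fun i (y : 'rV[R]_n) => a 0 i < y 0 i < b 0 i)
  (nbhs x) (nbhs_filter x)) => i.
apply: (@coord_continuous R 1 n 0 i x `]a 0 i, b 0 i[%classic).
apply: open_nbhs_nbhs; split; first exact: interval_open.
by rewrite /= in_itv; exact: abx.
Qed.

(** The grid with N.+1 points per side and mesh h = d * harmonic N lies in the
    cube.  A box with sides w_i contains at most \prod_i (w_i / h + 1) of these
    points, and the boxes together contain all (d / h) ^+ n of them; multiply
    by h ^+ n.  The covering hypothesis counts the boxes that contain x. *)
Lemma grid_count (I : Type) (D : seq I) (a b : I -> 'rV[R]_n)
    (c : 'rV[R]_n) (d : R) (N : nat) : 0 < d ->
  (forall m i, a m 0 i <= b m 0 i) ->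
  (forall x, cube c d x -> \sum_(m <- D) `[< open_box (a m) (b m) x >] > 0)%N ->
  d ^+ n <= \sum_(m <- D) \prod_(i < n) (b m 0 i - a m 0 i + d * harmonic N).
Proof.
move=> d0 ab cov; set h := d * _.
have h0 : 0 < h by rewrite mulr_gt0 // harmonic_gt0.
have hN : h * N.+1%:R = d by rewrite /h /harmonic /= mulfVK // pnatr_eq0.
pose F m i := [pred z : 'I_N.+1 |
  (a m 0 i - c 0 i) / h < z%:R < (b m 0 i - c 0 i) / h].
have cardF m : #|family (F m)|%:R * h ^+ n <=
    \prod_(i < n) (b m 0 i - a m 0 i + h).
  rewrite card_family foldrE big_map big_enum /= natr_prod.
  rewrite -[n in h ^+ n]card_ord -prodr_const -big_split /=.
  apply: ler_prod => i _; rewrite mulr_ge0 ?ler0n ?(ltW h0) //=.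
  apply: le_trans (ler_wpM2r (ltW h0) (card_ord_interval _ _)) _.
    by rewrite ler_pM2r ?invr_gt0 // lerD2r.
  by rewrite mulrDl mul1r -mulrBl divfK ?gt_eqF //; lra.
pose pt (z : {ffun 'I_n -> 'I_N.+1}) : 'rV[R]_n :=
  \row_i (c 0 i + h * (z i)%:R).
have ptF m z : (z \in family (F m)) = `[< open_box (a m) (b m) (pt z) >].
  apply/familyP/asboolP => Fz i; have := Fz i; rewrite !inE mxE;
  by rewrite ltr_pdivrMr // ltr_pdivlMr // => /andP[? ?]; apply/andP; split; lra.
have count : (N.+1 ^ n <= \sum_(m <- D) #|family (F m)|)%N.
  rewrite -[X in (X ^ _)%N]card_ord -[n in (_ ^ n)%N]card_ord -card_ffun.
  have -> : (\sum_(m <- D) #|family (F m)| =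
      \sum_z \sum_(m <- D) `[< open_box (a m) (b m) (pt z) >])%N.
    rewrite exchange_big /=; apply: eq_bigr => m _.
    rewrite -sum1_card big_mkcond /=; apply: eq_bigr => z _.
    by rewrite ptF; case: asbool.
  rewrite -sum1_card; apply: leq_sum => z _.
  have /cov : cube c d (pt z).
    move=> i /=; rewrite mxE in_itv /= lerDl lerD2l -hN.
    by rewrite mulr_ge0 ?ler0n ?(ltW h0) // ler_pM2l // ler_nat ltnW.
  exact.
rewrite -hN exprMn mulrC -natrX.
apply: le_trans (ler_sum _ (fun m _ => cardF m)).
by rewrite -mulr_suml ler_pM2r ?exprn_gt0 // -natr_sum ler_nat.
Qed.

Lemma cube_cover_volume (I : Type) (D : seq I) (a b : I -> 'rV[R]_n)
    (c : 'rV[R]_n) (d : R) : 0 < d ->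
  (forall m i, a m 0 i <= b m 0 i) ->
  (forall x, cube c d x -> \sum_(m <- D) `[< open_box (a m) (b m) x >] > 0)%N ->
  d ^+ n <= \sum_(m <- D) \prod_(i < n) (b m 0 i - a m 0 i).
Proof.
move=> d0 ab cov.
apply: (@cvgr_to_ge _ \oo _ _
  (fun N => \sum_(m <- D)
    \prod_(i < n) (b m 0 i - a m 0 i + d * harmonic N))); last first.
  by apply: nearW => N; exact: grid_count cov.
apply: cvg_big => [|m _]; first exact: add_continuous.
apply: cvg_big => [|i _]; first exact: mul_continuous.
rewrite -[X in _ --> X]addr0; apply: cvgD; first exact: cvg_cst.
by rewrite -(mulr0 d); apply: cvgM; [exact: cvg_cst|exact: cvg_harmonic].
Qed.

Lemma open_lebesgue_null (A : set 'rV[R]_n) :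
  open A -> lebesgue_null A -> A = set0.
Proof.
move=> Aopen Anull; rewrite -subset0 => x0 Ax0.
have /nbhs_ballP[e /= e0 eA] : nbhs x0 A by exact: open_nbhs_nbhs.
have d0 : 0 < e / 2 by rewrite divr_gt0.
have cubeA : cube x0 (e / 2) `<=` A.
  move=> x cx; apply: eA; split=> // i j; rewrite !ord1.
  have := cx j; rewrite /ball /= in_itv /= => /andP[? ?].
  by rewrite ltr_norml; apply/andP; split; lra.
have [D [a [b [ab covA vol]]]] := Anull ((e / 2) ^+ n / 2)
  (divr_gt0 (exprn_gt0 n d0) (ltr0n _ 2)).
have : cover_compact (cube x0 (e / 2)).
  by rewrite -compact_cover; exact: compact_cube.
move=> /(_ _ D (fun m => open_box (a m) (b m))) [m _||D' D'D cov].
- exact: open_open_box.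
- exact: subset_trans cubeA covA.
have : (e / 2) ^+ n <=
    \sum_(m <- enum_fset D') \prod_(i < n) (b m 0 i - a m 0 i).
  apply: (cube_cover_volume d0 ab) => x /cov[m /= mD' xm].
  by rewrite (big_rem m) //=; case: asboolP.
apply/negP; rewrite -ltNge.
apply: (@le_lt_trans _ _ ((e / 2) ^+ n / 2)); last first.
  by have := exprn_gt0 n d0; lra.
rewrite -lee_fin; apply: le_trans vol; apply: esum_ge.
exists [set` D'].
  by split=> [|m /= /D'D]; [exact: finite_fset|rewrite inE].
by rewrite -sumEFin fsbig_finite /= ?set_fsetK.
Qed.
End Covers.

Lemma continuous_ae_eq0 (R : realType) (n : nat) (U : set 'rV[R]_n)
    (h : 'rV[R]_n -> R) :
  open U -> (forall x, U x -> {for x, continuous h}) ->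
  for_almost_all U (fun x => h x = 0) -> forall x, U x -> h x = 0.
Proof.
move=> Uopen hcont hae x Ux; apply: contrapT => hx.
suff /open_lebesgue_null/(_ hae) Z0 : open [set x | U x /\ ~ h x = 0].
  by have : set0 x by rewrite -Z0.
rewrite openE => z [Uz /eqP hz].
apply: (@filterS2 _ (nbhs z) _ U [set y | h y != 0]).
- by move=> y Uy /eqP hy.
- by apply: open_nbhs_nbhs; split.
- apply: (hcont z Uz [set t : R | t != 0]).
  by apply: open_nbhs_nbhs; split; [exact: open_neq|].
Qed.

(** * Smooth functions: slices and linear combinations *)

Section Smooth.
Variables (R : realType) (W : normedModType R).
Implicit Types (A : set W) (f g : W -> R).

Lemma smooth_upto_continuous m A f x :
  smooth_upto m A f -> A x -> {for x, continuous f}.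
Proof. by case: m => [|m] [fcont _]; exact: fcont. Qed.

(** An affine map emb with linear part lin turns the difference quotient of
    F \o emb along v into that of F along lin v, so that directional
    derivatives of all orders are compositions with emb as well. *)
Lemma smooth_upto_comp_affine (W' : normedModType R) m A (B : set W')
    (emb lin : W -> W') (F : W' -> R) :
  continuous emb -> (forall h v x, emb (h *: v + x) = h *: lin v + emb x) ->
  (forall x, A x -> B (emb x)) ->
  smooth_upto m B F -> smooth_upto m A (F \o emb).
Proof.
move=> emb_cont emb_aff AB.
elim: m F => [|m IH] F [Fcont Fder]; split.
- by move=> x Ax; apply: continuous_comp; [exact: emb_cont|exact/Fcont/AB].
- by [].
- by move=> x Ax; apply: continuous_comp; [exact: emb_cont|exact/Fcont/AB].
move=> v; have [Fv DFv] := Fder (lin v).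
have quotE x :
    (fun h : R => h^-1 *: ((F \o emb \o shift x) (h *: v) - F (emb x)))
    = (fun h => h^-1 *: ((F \o shift (emb x)) (h *: lin v) - F (emb x))).
  by apply/funext => h; rewrite /= emb_aff.
split=> [x Ax|].
  by rewrite /derivable quotE; exact/Fv/AB.
suff -> : (fun x => 'D_v (F \o emb) x) = (fun x => 'D_(lin v) F x) \o emb.
  exact: IH.
by apply/funext => x; rewrite /derive quotE.
Qed.

(** Needed because the derivative of a sum is the sum of derivatives only at
    the points of A, whereas smooth_upto speaks of total functions. *)
Lemma smooth_upto_ext m A f g : open A -> (forall x, A x -> f x = g x) ->
  smooth_upto m A f -> smooth_upto m A g.
Proof.
move=> Aopen; elim: m f g => [|m IH] f g fg [fcont fder].
all: have near_fg x : A x -> \forall y \near x, f y = g y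
  by move=> Ax; apply: filterS fg _; exact: open_nbhs_nbhs.
all: have gcont x : A x -> {for x, continuous g}
  by move=> Ax; rewrite /prop_for /continuous_at -(fg x Ax);
  apply: cvg_trans (fcont x Ax); exact/near_eq_cvg/near_fg.
all: split=> // v.
have [fv Dfv] := fder v; split.
  by move=> x Ax; apply: near_eq_derivable (fv x Ax); exact: near_fg.
by apply: IH Dfv => x Ax; apply: near_eq_derive; exact: near_fg.
Qed.

Lemma smooth_upto_axpy m A f g (a : R) : open A ->
  smooth_upto m A f -> smooth_upto m A g ->
  smooth_upto m A (fun x => a * f x + g x).
Proof.
move=> Aopen; elim: m f g => [|m IH] f g [fcont fder] [gcont gder].
all: have cont x : A x -> {for x, continuous (fun x => a * f x + g x)}
  by move=> Ax; apply: cvgD;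
  [apply: cvgM; [exact: cvg_cst|exact: fcont]|exact: gcont].
all: split=> // v.
have [[fv Dfv] [gv Dgv]] := (fder v, gder v).
split=> [x Ax|].
  exact: (derivableD (derivableZ (k := a) (fv x Ax)) (gv x Ax)).
apply: smooth_upto_ext (IH _ _ Dfv Dgv) => // x Ax.
rewrite (deriveD (derivableZ (k := a) (fv x Ax)) (gv x Ax)) deriveZ //.
exact: fv.
Qed.

Lemma smooth_cst A (a : R) : smooth A (fun=> a).
Proof.
move=> m; elim: m a => [|m IH] a.
all: have cont x : A x -> {for x, continuous (fun=> a)}
  by move=> _; exact: cvg_cst.
all: split=> // v.
split=> [x _|]; first exact: (derivable_cst a).
suff -> : (fun x => 'D_v (fun=> a) x) = (fun=> 0) by exact: IH.
by apply/funext => x; exact: (derive_cst a).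
Qed.

Lemma smooth_lincomb k A (a : 'I_k -> R) (f : 'I_k -> W -> R) : open A ->
  (forall i, smooth A (f i)) -> smooth A (fun x => \sum_i a i * f i x).
Proof.
move=> Aopen fsmooth m.
elim: k a f fsmooth => [|k IH] a f fsmooth.
  under eq_fun do rewrite big_ord0; exact: smooth_cst.
under eq_fun do rewrite big_ord_recl.
apply: smooth_upto_axpy => //; first exact: fsmooth.
by apply: IH => i; exact: fsmooth.
Qed.

Lemma smooth_slicel (W' : normedModType R) A (B : set W') (F : W * W' -> R) y :
  B y -> smooth (A `*` B) F -> smooth A (fun x => F (x, y)).
Proof.
move=> By Fsmooth m.
apply: (smooth_upto_comp_affine (emb := fun x => (x, y))
    (lin := fun v => (v, 0))) (Fsmooth m) => [x|h v x|x Ax].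
- by apply: cvg_pair; [exact: cvg_id|exact: cvg_cst].
- by congr (_, _); rewrite /= scaler0 add0r.
- by split.
Qed.

Lemma smooth_slicer (W' : normedModType R) A (B : set W') (F : W' * W -> R) x :
  B x -> smooth (B `*` A) F -> smooth A (fun y => F (x, y)).
Proof.
move=> Bx Fsmooth m.
apply: (smooth_upto_comp_affine (emb := fun y => (x, y))
    (lin := fun v => (0, v))) (Fsmooth m) => [y|h v y|y Ay].
- by apply: cvg_pair; [exact: cvg_cst|exact: cvg_id].
- by congr (_, _); rewrite /= scaler0 add0r.
- by split.
Qed.
End Smooth.

(** * Uniqueness of power series and Taylor coefficients *)

Section PowerSeries.
Variable R : realType.

Lemma sum_exp_le (u : R) N : 0 <= u <= 2^-1 ->
  \sum_(j < N) u ^+ j.+1 <= 2 * u.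
Proof.
move=> /andP[u0 u1]; elim: N => [|N IH]; first by rewrite big_ord0; lra.
rewrite big_ord_recl expr1.
under eq_bigr => j _ do rewrite lift0 exprS.
rewrite -mulr_sumr; nra.
Qed.

(** Convergence at r bounds the terms a_m * r ^+ m by some B; at t = r * u with
    u <= 1/2 the terms of positive degree then add up to at most 2 * B * u,
    which tends to 0 with u. *)
Lemma power_series_constant_term (a : nat -> R) (r : R) : 0 < r ->
  (forall t, 0 < t <= r -> series (fun m => a m * t ^+ m) @ \oo --> (0 : R)) ->
  a 0%N = 0.
Proof.
move=> r0 az.
have /cvgP/cvg_series_cvg_0/cvgP/cvg_seq_bounded[M [_ Mb]] :
    series (fun m => a m * r ^+ m) @ \oo --> (0 : R).
  by apply: az; rewrite r0 lexx.
have {Mb} [B B0 aB] : exists2 B, 0 < B & forall m, `|a m * r ^+ m| <= B.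
  exists (`|M| + 1); first by rewrite ltr_wpDl.
  move=> m; apply: (Mb (`|M| + 1)) => //.
  by rewrite (le_lt_trans (ler_norm M)) ?ltrDl.
have small u : 0 < u <= 2^-1 -> `|a 0%N| <= 2 * B * u.
  move=> /andP[u0 u1].
  have tu : 0 < r * u <= r by apply/andP; split; [exact: mulr_gt0|nra].
  have := az _ tu; rewrite -cvg_shiftS => Stail.
  have : `|series (fun m => a m * (r * u) ^+ m) N.+1 - a 0%N| @[N --> \oo] -->
      `|0 - a 0%N| by apply: cvg_norm; apply: cvgB => //; exact: cvg_cst.
  rewrite sub0r normrN => /cvgr_to_le; apply; apply: nearW => N.
  rewrite /series /= big_mkord big_ord_recl expr0 mulr1 addrC addKr.
  apply: le_trans (ler_norm_sum _ _ _) _.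
  apply: (@le_trans _ _ (\sum_(j < N) B * u ^+ j.+1)).
    apply: ler_sum => j _; rewrite lift0 exprMn mulrA normrM.
    rewrite (ger0_norm (exprn_ge0 _ (ltW u0))).
    by rewrite ler_wpM2r ?exprn_ge0 ?(ltW u0).
  rewrite -mulr_sumr (mulrC 2 B) -mulrA ler_wpM2l ?(ltW B0) //.
  by apply: sum_exp_le; rewrite u1 ltW.
apply/eqP; rewrite -normr_le0 leNgt; apply/negP => a0.
have d0 : 0 < 4 * (B + `|a 0%N|) by lra.
have /small : 0 < `|a 0%N| / (4 * (B + `|a 0%N|)) <= 2^-1.
  by rewrite divr_gt0 //= ler_pdivrMr //; lra.
by rewrite mulrA ler_pdivlMr //; nra.
Qed.

(** Once the constant term is known to vanish, dividing by t yields a series of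
    the same kind for the shifted coefficients.  This is why only t > 0 is
    considered. *)
Lemma power_series_eq0 (a : nat -> R) (r : R) : 0 < r ->
  (forall t, 0 < t <= r -> series (fun m => a m * t ^+ m) @ \oo --> (0 : R)) ->
  forall m, a m = 0.
Proof.
move=> r0 az m; elim: m a az => [|m IH] a az.
  exact: power_series_constant_term az.
apply: (IH (fun m => a m.+1)) => t /[dup] tr /andP[t0 _].
have a0 := power_series_constant_term r0 az.
have /= := az _ tr; rewrite -cvg_shiftS => Stail.
rewrite (_ : series _ = fun N => t^-1 * series (fun m => a m * t ^+ m) N.+1).
  by rewrite -(mulr0 t^-1); apply: cvgM; [exact: cvg_cst|].
apply/funext => N; rewrite /series /= !big_mkord big_ord_recl a0 mul0r add0r.
rewrite mulr_sumr; apply: eq_bigr => j _; rewrite lift0 exprS.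
by rewrite mulrCA mulKf ?gt_eqF.
Qed.
End PowerSeries.

Section TaylorUniqueness.
Variable R : realType.

Definition base_value n (b : nat) (d : 'I_n -> nat) : nat :=
  \sum_(i < n) d i * b ^ i.

Lemma base_value_inj n b (d e : 'I_n -> nat) :
  (forall i, d i < b)%N -> (forall i, e i < b)%N ->
  base_value b d = base_value b e -> d =1 e.
Proof.
elim: n d e => [|n IH] d e db eb; first by move=> _ [].
have valS (f : 'I_n.+1 -> nat) :
    base_value b f = (base_value b (f \o lift ord0) * b + f ord0)%N.
  rewrite /base_value big_ord_recl expn0 muln1 addnC big_distrl /=.
  congr (_ + _)%N; apply: eq_bigr => i _.
  by rewrite /= /bump add1n expnSr mulnA.
rewrite !valS => val_eq.
have b0 : (0 < b)%N by exact: leq_ltn_trans (db ord0).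
have head : d ord0 = e ord0.
  by have := congr1 (modn^~ b) val_eq; rewrite /= !modnMDl !modn_small.
move: val_eq; rewrite head => /eqP; rewrite eqn_add2r eqn_pmul2r // => /eqP.
move=> /(IH _ _ (fun i => db _) (fun i => eb _)) tail i.
by case: (unliftP ord0 i) => [j|] ->; [exact: tail|].
Qed.

Lemma infinitely_many_roots_eq0 (P : {poly R}) :
  (forall t, 0 < t <= 1 -> P.[t] = 0) -> P = 0.
Proof.
move=> P0; apply/eqP/negPn/negP => Pneq0.
(* The roots 1, 1/2, 1/3, ... are more numerous than the degree allows. *)
have := max_poly_roots Pneq0 (rs := [seq harmonic i | i <- iota 0 (size P)]).
rewrite size_map size_iota ltnn => H; suff : false by []; apply: H.
  apply/allP => _ /mapP[i _ ->]; apply/rootP/P0.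
  by rewrite harmonic_gt0 /harmonic /= invf_le1 // ler1n.
rewrite map_inj_uniq ?iota_uniq // => i j /invr_inj/eqP.
by rewrite eqr_nat => /eqP[].
Qed.

(** Kronecker substitution v_i = tau ^+ (m.+1 ^ i): the monomial with exponents
    t becomes the power of tau whose exponent has the base m.+1 digits t, so
    distinct monomials become distinct powers of the single variable tau. *)
Lemma homogeneous_eq0 n m (e : {ffun 'I_n -> 'I_m.+1} -> R)
    (P : pred {ffun 'I_n -> 'I_m.+1}) :
  (forall v : 'rV[R]_n, (forall i, 0 <= v 0 i <= 1) ->
    \sum_(t | P t) e t * \prod_(i < n) v 0 i ^+ t i = 0) ->
  forall t, P t -> e t = 0.
Proof.
move=> ez t0 Pt0.
pose code (t : {ffun 'I_n -> 'I_m.+1}) := base_value m.+1 (fun i => t i).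
have code_inj : injective code.
  move=> s t /base_value_inj st; apply/ffunP => i; apply: val_inj.
  by apply: st => j; exact: ltn_ord.
pose Q : {poly R} := \sum_(t | P t) e t *: 'X^(code t).
have Q0 : Q = 0.
  apply: infinitely_many_roots_eq0 => tau /andP[tau0 tau1].
  rewrite -(ez (\row_i tau ^+ (m.+1 ^ i))) => [|i].
    rewrite /Q horner_sum; apply: eq_bigr => t _; rewrite hornerZ hornerXn.
    rewrite /code /base_value -prodrXr; congr (_ * _); apply: eq_bigr => i _.
    by rewrite mxE mulnC exprM.
  by rewrite mxE exprn_ge0 ?exprn_ile1 // ltW.
have := congr1 (fun p : {poly R} => p`_(code t0)) Q0.
rewrite coef0 coef_sum (bigD1 t0) //= coefZ coefXn eqxx mulr1 big1 ?addr0 //.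
move=> t /andP[_ tt0]; rewrite coefZ coefXn (inj_eq code_inj) eq_sym.
rewrite (negPf tt0).
exact: mulr0.
Qed.

(** On a segment p + t *: v the degree m part of the expansion is t ^+ m times a
    homogeneous polynomial in v, which therefore vanishes for every small
    direction v, and with it all its coefficients. *)
Lemma taylor_expansion_eq0 n (V : set 'rV[R]_n) (p : 'rV[R]_n)
    (e : multi_index n -> 'rV[R]_n -> R) x : open V -> V p ->
  (forall y, V y -> series (taylor_term p e x y) @ \oo --> (0 : R)) ->
  forall s, e s x = 0.
Proof.
move=> Vopen Vp ez s.
have /nbhs_ballP[r /= r0 rV] : nbhs p V by exact: open_nbhs_nbhs.
(* Coordinates of v in [0, 1] and t <= r / 2 keep p + t *: v in the ball. *)
have r20 : 0 < r / 2 by rewrite divr_gt0.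
pose m := (\sum_i s i)%N.
have le_s i : (s i < m.+1)%N by rewrite ltnS /m (bigD1 i) //= leq_addr.
pose t0 : {ffun 'I_n -> 'I_m.+1} := [ffun i => Ordinal (le_s i)].
have t0E : [ffun i => t0 i : nat] = s by apply/ffunP => i; rewrite !ffunE.
rewrite -t0E.
apply: (@homogeneous_eq0 n m (fun t => e [ffun i => t i : nat] x)
  (fun t => (\sum_(i < n) (t i : nat))%N == m)); last first.
  by apply/eqP/eq_bigr => i _; rewrite ffunE.
move=> v v01.
pose term m' := \sum_(t : {ffun 'I_n -> 'I_m'.+1} |
  (\sum_(i < n) (t i : nat))%N == m') e [ffun i => t i : nat] x *
  \prod_(i < n) v 0 i ^+ t i.
apply: (@power_series_eq0 R term (r / 2)) => // t /andP[t0' tr].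
have : V (p + t *: v).
  apply: rV; split=> // i j; rewrite !ord1 /ball /= !mxE opprD addNKr normrN.
  have /andP[v0 v1] := v01 j.
  rewrite ger0_norm ?mulr_ge0 ?(ltW t0') //.
  by apply: (@le_lt_trans _ _ t); [rewrite ler_piMr // ltW|lra].
move=> /ez.
suff -> : taylor_term p e x (p + t *: v) = fun m' => term m' * t ^+ m' by [].
apply/funext => m'; rewrite /taylor_term /term mulr_suml.
apply: eq_bigr => u /eqP um'; rewrite -mulrA; congr (_ * _).
have -> : t ^+ m' = \prod_(i < n) t ^+ u i by rewrite prodrXr um'.
rewrite /monomial -big_split /=; apply: eq_bigr => i _.
by rewrite ffunE addrC addKr mxE exprMn mulrC.
Qed.
End TaylorUniqueness.

(** * Independence almost everywhere and sample points *)

Section Independence.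
Variables (R : realType) (n : nat).
Implicit Types U : set 'rV[R]_n.

Lemma lebesgue_null_set0 : lebesgue_null (@set0 'rV[R]_n).
Proof.
move=> e e0; exists set0, (fun=> 0), (fun=> 0); split=> [//|x []|].
by rewrite esum_set0 lee_fin ltW.
Qed.

Lemma linearly_independent_sample k U (f : 'I_k -> 'rV[R]_n -> R) :
  linearly_independent U f ->
  exists x : 'I_k -> 'rV[R]_n,
    (forall i, U (x i)) /\ \matrix_(i < k, j < k) f j (x i) \in unitmx.
Proof.
move=> findep; apply: exists_unit_sample => alpha alpha0; apply: findep.
rewrite /for_almost_all (_ : [set x | _] = set0).
  exact: lebesgue_null_set0.
by rewrite -subset0 => x [Ux]; rewrite alpha0.
Qed.

(** By continuity a combination that vanishes almost everywhere vanishes at the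
    sample points, where the invertible matrix forces the coefficients to be
    zero. *)
Lemma sample_linearly_independent k U (f : 'I_k -> 'rV[R]_n -> R)
    (x : 'I_k -> 'rV[R]_n) :
  open U -> (forall j, smooth U (f j)) -> (forall i, U (x i)) ->
  \matrix_(i < k, j < k) f j (x i) \in unitmx -> linearly_independent U f.
Proof.
move=> Uopen fsmooth Ux Funit alpha alpha_ae.
have alpha0 : forall z, U z -> \sum_(j < k) alpha j * f j z = 0.
  apply: (continuous_ae_eq0 Uopen) alpha_ae => z Uz.
  exact: smooth_upto_continuous (smooth_lincomb alpha Uopen fsmooth 0) Uz.
have : (\matrix_(i < k, j < k) f j (x i)) *m (\col_j alpha j) = 0.
  apply/colP => i; rewrite !mxE -[RHS](alpha0 _ (Ux i)).
  by apply: eq_bigr => j _; rewrite !mxE mulrC.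
move=> /(congr1 (mulmx (invmx (\matrix_(i < k, j < k) f j (x i))))).
by rewrite mulKmx // mulmx0 => /colP + j => /(_ j); rewrite !mxE.
Qed.
End Independence.

(** * Rank, separation and Taylor functions *)

Section RankSeparation.
Variables (R : realType) (n : nat) (U V : set 'rV[R]_n).
Variable psi : 'rV[R]_n -> 'rV[R]_n -> R.

Lemma rank_le_sum k (f g : 'I_k -> 'rV[R]_n -> R) :
  (forall u v, U u -> V v -> psi u v = \sum_(j < k) f j u * g j v) ->
  rank_le U V psi k.
Proof.
move=> psiE m x y Ux Vy.
have -> : \matrix_(i < m, j < m) psi (x i) (y j) =
    \matrix_(i < m, l < k) f l (x i) *m \matrix_(l < k, j < m) g l (y j).
  apply/matrixP => i j; rewrite !mxE psiE //.
  by apply: eq_bigr => l _; rewrite !mxE.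
exact: mulmx_max_rank.
Qed.

Lemma separates_has_rank k : separates U V psi k -> has_rank U V psi k.
Proof.
move=> [f [g [_ _ findep gindep psiE]]]; split; first exact: rank_le_sum psiE.
move=> k' rk'.
have [x [Ux Funit]] := linearly_independent_sample findep.
have [y [Vy Gunit]] := linearly_independent_sample gindep.
have := rk' _ x y Ux Vy.
have -> : \matrix_(i < k, j < k) psi (x i) (y j) =
    \matrix_(i < k, l < k) f l (x i) *m (\matrix_(j < k, l < k) g l (y j))^T.
  apply/matrixP => i j; rewrite !mxE psiE //.
  by apply: eq_bigr => l _; rewrite !mxE.
by rewrite mxrank_unit // unitmx_mul Funit unitmx_tr.
Qed.

Hypotheses (openU : open U) (openV : open V).
Hypothesis smooth_psi : smooth (U `*` V)
  (fun z : ('rV[R]_n * 'rV[R]_n)%type => psi z.1 z.2).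

Lemma smooth_section_l v : V v -> smooth U (psi^~ v).
Proof. by move=> Vv; exact: smooth_slicel Vv smooth_psi. Qed.

Lemma smooth_section_r u : U u -> smooth V (psi u).
Proof. by move=> Uu; exact: smooth_slicer Uu smooth_psi. Qed.

Lemma has_rank_separates k : has_rank U V psi k -> separates U V psi k.
Proof.
move=> psirank; have [x [y [Ux Vy Aunit]]] := has_rank_unit_sample psirank.
pose g j v := \sum_i invmx (sample_mx psi x y) j i * psi (x i) v.
have fsmooth j : smooth U (psi^~ (y j)) by exact: smooth_section_l.
have gsmooth j : smooth V (g j).
  by apply: smooth_lincomb => // i; exact: smooth_section_r.
exists (fun j => psi^~ (y j)), g; split=> //.
- exact: sample_linearly_independent Ux Aunit.
(* The sample matrix of g at y is the transpose of A^-1 A. *)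
- apply: (sample_linearly_independent openV gsmooth Vy).
  rewrite (_ : \matrix_(i, j) _ = 1%:M) ?unitmx1 //.
  rewrite -[RHS]trmx1 -(mulVmx Aunit); apply/matrixP => i j; rewrite !mxE.
  by apply: eq_bigr => l _; rewrite !mxE.
- by move=> u v Uu Vv; exact: rank_le_interpolation psirank.1 Ux Vy Aunit Uu Vv.
Qed.

Variables (p : 'rV[R]_n) (c : multi_index n -> 'rV[R]_n -> R).
Hypotheses (Vp : V p) (taylor_psi : taylor_functions U V p psi c).

(** The coefficients c s u - \sum_i w i * c s (x i) are those of the expansion
    about p of psi u - \sum_i w i * psi (x i), and this expansion determines
    them and is determined by them. *)
Lemma taylor_relationP k (x : 'I_k -> 'rV[R]_n) (w : 'I_k -> R) u :
  (forall i, U (x i)) -> U u ->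
  (forall s, c s u = \sum_i w i * c s (x i)) <->
  (forall v, V v -> psi u v = \sum_i w i * psi (x i) v).
Proof.
move=> Ux Uu.
pose e s (_ : 'rV[R]_n) := c s u - \sum_i w i * c s (x i).
have e_cvg v : V v -> series (taylor_term p e u v) @ \oo -->
    (psi u v - \sum_i w i * psi (x i) v).
  move=> Vv.
  have -> : series (taylor_term p e u v) = fun N =>
      series (taylor_term p c u v) N -
      \sum_i w i * series (taylor_term p c (x i) v) N.
    apply/funext => N; rewrite /series /=.
    under [X in _ - X]eq_bigr => i _ do rewrite mulr_sumr.
    rewrite exchange_big -sumrB; apply: eq_bigr => m _ /=.
    under [X in _ - X]eq_bigr => i _ do rewrite mulr_sumr.
    rewrite exchange_big -sumrB; apply: eq_bigr => t _ /=.
    rewrite /e mulrBl mulr_suml; congr (_ - _).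
    by apply: eq_bigr => i _; rewrite mulrA.
  apply: cvgB; first exact: taylor_psi.
  apply: cvg_big => [|i _]; first exact: add_continuous.
  by apply: cvgM; [exact: cvg_cst|exact: taylor_psi].
split=> [cE v Vv|psiE s].
  apply/eqP; rewrite -subr_eq0; apply/eqP.
  apply: (@cvg_unique _ (@norm_hausdorff _ R) _ _ _ _ (e_cvg v Vv)).
  rewrite (_ : series _ = fun=> 0); first exact: cvg_cst.
  apply/funext => N; rewrite /series /= big1 // => m _.
  by rewrite /taylor_term big1 // => t _; rewrite /e cE subrr mul0r.
apply/eqP; rewrite -subr_eq0; apply/eqP.
apply: (@taylor_expansion_eq0 _ _ V p e u openV Vp) => v Vv.
by have := e_cvg v Vv; rewrite psiE // subrr.
Qed.

(** The weights w i u interpolate each f_j from its values at the x_i, hence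
    everything in the span of the f_j, in particular every Taylor function. *)
Lemma taylor_spanned_rank_le k : taylor_spanned U c k -> rank_le U V psi k.
Proof.
move=> [f [_ findep cspan]].
have [x [Ux Funit]] := linearly_independent_sample findep.
set F := (\matrix_(i, j) _) in Funit.
pose w i u := ((\row_j f j u) *m invmx F) 0 i.
apply: (@rank_le_sum k w (fun i => psi (x i))) => u v Uu.
move: v; apply/(taylor_relationP _ Ux Uu) => s.
have [a cE] := cspan s; rewrite cE //.
have fE j : f j u = \sum_i w i u * f j (x i).
  transitivity (((\row_j f j u) *m invmx F *m F) 0 j).
    by rewrite mulmxKV // mxE.
  by rewrite mxE; apply: eq_bigr => i _; rewrite [in F i j]mxE.
under [RHS]eq_bigr => i _ do rewrite cE // mulr_sumr.
rewrite exchange_big; apply: eq_bigr => j _ /=.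
by rewrite fE mulr_sumr; apply: eq_bigr => i _; rewrite mulrCA.
Qed.

(** The interpolation formula expresses psi u through the psi (x_i) with weights
    that are combinations of the psi u (y_j), and c s u is then expressed
    through the numbers c s (x_i) with the same weights. *)
Lemma has_rank_taylor_spanned k : has_rank U V psi k -> taylor_spanned U c k.
Proof.
move=> psirank; have [x [y [Ux Vy Aunit]]] := has_rank_unit_sample psirank.
have fsmooth j : smooth U (psi^~ (y j)) by exact: smooth_section_l.
exists (fun j => psi^~ (y j)); split=> //.
  exact: sample_linearly_independent Ux Aunit.
move=> s; set B := invmx (sample_mx psi x y) in Aunit *.
exists (fun j => \sum_i B j i * c s (x i)) => u Uu.
pose w i := \sum_j psi u (y j) * B j i.
have /(taylor_relationP _ Ux Uu) -> : forall v, V v ->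
    psi u v = \sum_i w i * psi (x i) v.
  move=> v Vv.
  rewrite [LHS](rank_le_interpolation psirank.1 Ux Vy Aunit Uu Vv).
  under [RHS]eq_bigr => i _ do rewrite mulr_suml.
  rewrite exchange_big; apply: eq_bigr => j _ /=.
  by rewrite mulr_sumr; apply: eq_bigr => i _; rewrite mulrA.
under eq_bigr => i _ do rewrite mulr_suml.
rewrite exchange_big; apply: eq_bigr => j _ /=.
by rewrite mulr_suml; apply: eq_bigr => i _; rewrite [RHS]mulrC mulrA.
Qed.

Lemma has_rank_taylor_spanned_min k :
  has_rank U V psi k <-> taylor_spanned_min U c k.
Proof.
split=> [psirank|[cspan kmin]]; split.
- exact: has_rank_taylor_spanned.
- by move=> k' /taylor_spanned_rank_le; exact: psirank.2.
- exact: taylor_spanned_rank_le.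
- move=> k' /has_rank_exists[r rk' /has_rank_taylor_spanned/kmin].
  by move=> /leq_trans; apply.
Qed.
End RankSeparation.

Theorem proposition1 (R : realType) (n : nat) (U V : set 'rV[R]_n)
    (p : 'rV[R]_n) (psi : 'rV[R]_n -> 'rV[R]_n -> R)
    (c : multi_index n -> 'rV[R]_n -> R) (k : nat)
    (openU : open U) (openV : open V) (Vp : V p)
    (smooth_psi : smooth (U `*` V)
       (fun z : ('rV[R]_n * 'rV[R]_n)%type => psi z.1 z.2))
    (taylor_psi : taylor_functions U V p psi c) :
  (has_rank U V psi k <-> separates U V psi k) /\
  (has_rank U V psi k <-> taylor_spanned_min U c k).
Proof.
split; last exact: (has_rank_taylor_spanned_min openU openV _ Vp).

by split; [apply: has_rank_separates|exact: separates_has_rank].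
Qed.
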